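(* For every finite simple graph $G$ with maximum degree $\Delta(G)$, the $\mathbb{Z}_2$-index of the box complex of the total graph of $G$ satisfies $$\operatorname{ind}(B(T(G)))\le \Delta(G).$$
   Context: The total graph $T(G)$ of a simple graph $G$ has vertex set $V(G)\cup E(G)$, and $\{a,b\}$ is an edge of $T(G)$ iff either $a,b\in V(G)$ and $\{a,b\}\in E(G)$; or $a\in V(G)$, $b\in E(G)$ and $a\in b$; or $a,b\in E(G)$ and $a\cap b\neq\emptyset$. For a graph $H$, the box complex $B(H)$ is the simplicial complex with vertex set $V(H)\times\{1\}\cup V(H)\times\{2\}$. For $A,B\subseteq V(H)$ write $A\uplus B:=A\times\{1\}\cup B\times\{2\}$. Then $A\uplus B$ is a simplex of $B(H)$ iff every vertex of $A$ is adjacent to every vertex of $B$ (so that $H[A\cup B]$ contains the complete bipartite graph with classes $A$ and $B$), and in addition, if $A=\emptyset$ then the vertices of $B$ have a common neighbor in $H$, and if $B=\emptyset$ then the vertices of $A$ have a common neighbor in $H$. The geometric realization of $B(H)$ is a $\mathbb{Z}_2$-space with the free involution induced by the simplicial map $A\uplus B\mapsto B\uplus A$. For a $\mathbb{Z}_2$-space $T$ (with free involution $\nu$), $\operatorname{ind}(T)$ is the smallest $h$ such that there is a continuous $\mathbb{Z}_2$-equivariant map $T\to\mathbb{S}^h$, where the sphere $\mathbb{S}^h$ carries the antipodal involution. *)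

(* Defs.v *)
From HB Require Import structures.
From mathcomp Require Import all_boot all_order all_algebra.
From mathcomp Require Import all_classical all_reals all_analysis.

Set Implicit Arguments.
Unset Strict Implicit.
Unset Printing Implicit Defensive.
Import Order.TTheory GRing.Theory Num.Theory.
Import numFieldTopology.Exports numFieldNormedType.Exports.

Local Open Scope ring_scope.

Record sgraph := SGraph {
  vertex :> finType;
  adj : rel vertex;
  adj_sym : symmetric adj;
  adj_irrefl : irreflexive adj }.

Definition max_degree (G : sgraph) : nat :=
  (\max_(v : G) #|[set w | adj v w]%SET|)%N.

Definition edges (G : sgraph) : {set {set G}} :=
  [set [set x; y] | x in G, y in G & adj x y]%SET.

Definition edge (G : sgraph) : finType := {e : {set G} | e \in edges G}.

(* An edge of a graph is a pair of distinct vertices, so the clause for two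
   elements of E(G) carries [e != f]: otherwise e would be a loop, as e meets
   itself. *)
Definition total_adj (G : sgraph) : rel (G + edge G)%type := fun a b =>
  match a, b with
  | inl u, inl v => adj u v
  | inl u, inr e => u \in val e
  | inr e, inl u => u \in val e
  | inr e, inr f => (e != f) && (val e :&: val f != finset.set0)%SET
  end.

Lemma total_adj_sym (G : sgraph) : symmetric (@total_adj G).
Proof.
move=> [u|e] [v|f] //=; first exact: adj_sym.
by rewrite eq_sym finset.setIC.
Qed.

Lemma total_adj_irrefl (G : sgraph) : irreflexive (@total_adj G).
Proof. by move=> [u|e] /=; [exact: adj_irrefl | rewrite eqxx]. Qed.

Definition total_graph (G : sgraph) : sgraph :=
  SGraph (@total_adj_sym G) (@total_adj_irrefl G).

(* The elements of [W] that are in no simplex contribute no point to the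
   geometric realization. *)
Record scomplex (W : finType) := SComplex {
  simplices :> {set {set W}};
  simplices_sub : forall S T : {set W},
    S \in simplices -> T \subset S -> T \in simplices }.

(* Points are given by their barycentric coordinates.  The complex being
   finite, its topology is induced by the product topology. *)
Definition realization (R : realType) (W : finType) (K : scomplex W) :
    set {ptws W -> R} :=
  fun x => [/\ forall w, 0 <= x w, \sum_w x w = 1
             & [set w | x w != 0]%SET \in (K : {set {set W}})].
#[global] Arguments realization R {W} K.

Record Z2space := Z2Space {
  carrier :> topologicalType;
  invol : carrier -> carrier;
  involK : involutive invol;
  invol_continuous : continuous invol;
  invol_free : forall x, invol x <> x }.

Definition Z2map (X Y : Z2space) (f : X -> Y) : Prop :=
  continuous f /\ forall x, f (invol x) = invol (f x).

Definition sphere (R : realType) (h : nat) : set 'rV[R]_h.+1 :=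
  fun x => \sum_i x 0 i ^+ 2 = 1.
#[global] Arguments sphere R h : clear implicits.

Lemma sphereN (R : realType) (h : nat) (x : 'rV[R]_h.+1) :
  x \in sphere R h -> - x \in sphere R h.
Proof.
move=> /set_mem xS; apply/mem_set; rewrite /sphere -[RHS]xS.
by apply: eq_bigr => i _; rewrite mxE sqrrN.
Qed.

Definition antipode (R : realType) (h : nat) (x : sphere R h) : sphere R h :=
  exist _ (- val x) (sphereN (valP x)).

Lemma antipodeK (R : realType) (h : nat) : involutive (@antipode R h).
Proof. by move=> x; apply: val_inj; rewrite /= opprK. Qed.

Lemma antipode_continuous (R : realType) (h : nat) :
  continuous (@antipode R h).
Proof.
apply: continuous_comp_initial => x.
apply: (@continuous_comp _ _ _ (val : sphere R h -> 'rV[R]_h.+1) -%R).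
  exact: initial_continuous.
exact: opp_continuous.
Qed.

Lemma antipode_free (R : realType) (h : nat) (x : sphere R h) :
  antipode x <> x.
Proof.
move=> /(congr1 val)/= /eqP; rewrite eq_sym -subr_eq0 opprK => /eqP x0.
have := set_mem (valP x); rewrite /sphere big1 => [/eqP|i _].
  by rewrite eq_sym oner_eq0.
have /matrixP/(_ 0 i) := x0; rewrite !mxE => /eqP.
by rewrite -mulr2n mulrn_eq0 /= => /eqP ->; rewrite expr0n.
Qed.

Definition Z2sphere (R : realType) (h : nat) : Z2space :=
  Z2Space (@antipodeK R h) (@antipode_continuous R h) (@antipode_free R h).

(* [+oo] if [X] maps equivariantly to no sphere; the empty space has index 0, the
   smallest sphere considered being S^0. *)
Definition ind (R : realType) (X : Z2space) : \bar int :=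
  let has_map h := `[< exists f : X -> Z2sphere R h, Z2map f >] in
  match pselect (exists h, has_map h) with
  | left ex => ((ex_minn ex)%:Z)%:E
  | right _ => +oo%E
  end.

(* [inl v] is (v, 1) and [inr v] is (v, 2). *)
Definition uplus (V : finType) (A B : {set V}) : {set V + V} :=
  ([set inl a | a in A] :|: [set inr b | b in B])%SET.

Definition common_neighbor (H : sgraph) (A : {set H}) : bool :=
  [exists v, [forall a in A, adj v a]].

Definition box_simplex (H : sgraph) (A B : {set H}) : bool :=
  [&& [forall a in A, [forall b in B, adj a b]],
      (A == finset.set0) ==> common_neighbor B
    & (B == finset.set0) ==> common_neighbor A].

Lemma common_neighbor_sub (H : sgraph) (A B : {set H}) :
  A \subset B -> common_neighbor B -> common_neighbor A.
Proof.
move=> /fintype.subsetP AB /existsP[v /forall_inP vB].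
by apply/existsP; exists v; apply/forall_inP => a /AB; exact: vB.
Qed.

Lemma box_simplexC (H : sgraph) (A B : {set H}) :
  box_simplex A B = box_simplex B A.
Proof.
rewrite /box_simplex; congr andb; last exact: andbC.
by apply/forall_inP/forall_inP => + x xP => AB; apply/forall_inP => y yP;
  rewrite adj_sym; have /forall_inP := AB y yP; apply.
Qed.

Lemma box_simplex_neighbor (H : sgraph) (A B : {set H}) :
  box_simplex A B -> common_neighbor B.
Proof.
move=> /and3P[/forall_inP adjAB nB _].
have [A0|[a aA]] := finset.set_0Vmem A.
  by move: nB; rewrite A0 eqxx.
by apply/existsP; exists a; exact: adjAB.
Qed.

Lemma box_simplex_sub (H : sgraph) (A B A' B' : {set H}) :
  box_simplex A B -> A' \subset A -> B' \subset B -> box_simplex A' B'.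
Proof.
move=> AB sA sB; apply/and3P; split.
- move: AB => /and3P[/forall_inP adjAB _ _].
  apply/forall_inP => a /(fintype.subsetP sA) /adjAB /forall_inP adjaB.
  by apply/forall_inP => b /(fintype.subsetP sB); exact: adjaB.
- apply/implyP => _; apply: common_neighbor_sub sB _.
  exact: box_simplex_neighbor AB.
- apply/implyP => _; apply: common_neighbor_sub sA _.
  by apply: (@box_simplex_neighbor _ B); rewrite box_simplexC.
Qed.

Definition box_simplices (H : sgraph) : {set {set H + H}} :=
  [set uplus p.1 p.2 | p : {set H} * {set H} & box_simplex p.1 p.2]%SET.

Lemma in_uplusl (V : finType) (A B : {set V}) v :
  (inl v \in uplus A B) = (v \in A).
Proof.
rewrite finset.inE (mem_imset _ _ (can_inj (fun _ => erefl : (fun w : V + V =>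
  match w with inl u => u | inr u => u end) (inl _) = _))).
by rewrite orb_idr // => /finset.imsetP[].
Qed.

Lemma in_uplusr (V : finType) (A B : {set V}) v :
  (inr v \in uplus A B) = (v \in B).
Proof.
rewrite finset.inE (mem_imset _ _ (can_inj (fun _ => erefl : (fun w : V + V =>
  match w with inl u => u | inr u => u end) (inr _) = _))).
by rewrite orb_idl // => /finset.imsetP[].
Qed.

Lemma box_simplicesE (H : sgraph) (S : {set H + H}) :
  (S \in box_simplices H) = box_simplex (inl @^-1: S) (inr @^-1: S).
Proof.
apply/finset.imsetP/idP => [[[A B]]|SP].
  rewrite finset.inE /= => AB ->; congr is_true: AB.
  by congr box_simplex; apply/finset.setP => v;
    rewrite finset.inE (in_uplusl, in_uplusr).
exists (inl @^-1: S, inr @^-1: S); first by rewrite finset.inE.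
by apply/finset.setP => -[v|v]; rewrite (in_uplusl, in_uplusr) finset.inE.
Qed.

Lemma box_simplices_sub (H : sgraph) (S T : {set H + H}) :
  S \in box_simplices H -> T \subset S -> T \in box_simplices H.
Proof.
rewrite !box_simplicesE => SP TS.
by apply: box_simplex_sub SP _ _; exact: finset.preimsetS.
Qed.

Definition box_complex (H : sgraph) : scomplex (H + H)%type :=
  SComplex (@box_simplices_sub H).

(* The vertex map underlying the simplicial map [uplus A B] |-> [uplus B A]. *)
Definition flip (V : Type) (w : V + V) : V + V :=
  match w with inl v => inr v | inr v => inl v end.

Lemma flipK (V : Type) : involutive (@flip V).
Proof. by case. Qed.

(* The affine extension of a vertex map [s] sends [x] to the point whose
   [w]-coordinate is the sum of the [x v] with [s v = w]; for an involution
   [s], this is [x (s w)]. *)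
Lemma box_flip_subproof (R : realType) (H : sgraph)
    (x : {ptws (H + H)%type -> R}) :
  x \in realization R (box_complex H) ->
  (fun w => x (flip w)) \in realization R (box_complex H).
Proof.
move=> /set_mem[x_ge0 x1 xS]; apply/mem_set; split => [w||].
- exact: x_ge0.
- rewrite -[RHS]x1 [RHS](reindex_inj (inv_inj (@flipK H))).
  by [].
- move: xS; rewrite /= !box_simplicesE box_simplexC.
  by congr (is_true (box_simplex _ _)); apply/finset.setP => v;
    rewrite !finset.inE.
Qed.

Definition box_flip (R : realType) (H : sgraph)
    (x : realization R (box_complex H)) : realization R (box_complex H) :=
  exist _ (fun w => val x (flip w)) (box_flip_subproof (valP x)).

Lemma box_flipK (R : realType) (H : sgraph) : involutive (@box_flip R H).
Proof. by move=> x; apply: val_inj; apply/funext => -[]. Qed.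

Lemma box_flip_continuous (R : realType) (H : sgraph) :
  continuous (@box_flip R H).
Proof.
apply: continuous_comp_initial => x.
apply/cvg_sup.
  by apply: (@filter.fmap_filter _ _ _ _ (nbhs_filter x)).
move=> w.
move: x; apply: continuous_comp_initial => x.
apply: (@continuous_comp _ _ _
  (val : realization R (box_complex H) -> {ptws (H + H)%type -> R})
  (fun y : {ptws (H + H)%type -> R} => y (flip w))).
  exact: initial_continuous.
exact: proj_continuous.
Qed.

Lemma box_flip_free (R : realType) (H : sgraph)
    (x : realization R (box_complex H)) : box_flip x <> x.
Proof.
move=> /(congr1 val)/= xE.
have xflip w : val x (flip w) = val x w := congr1 (fun f => f w) xE.
have [_ x1 xS] := set_mem (valP x).
have [x0|[w xw]] : (forall w, val x w = 0) \/ exists w, val x w != 0.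
- have [/existsP ex|/existsPn ex] := boolP [exists w, val x w != 0].
    by right.
  by left=> w; apply/eqP/negPn/ex.
- by move: x1; rewrite big1 => [/eqP|w _ //]; rewrite eq_sym oner_eq0.
move: xS; rewrite /= box_simplicesE => /and3P[/forall_inP xS _ _].
have [v xl] : exists v, val x (inl v) != 0.
  by case: w xw => v xv; exists v => //; rewrite -xflip.
have /xS /forall_inP/(_ v) : v \in (inl @^-1: [set w | val x w != 0])%SET.
  by rewrite !finset.inE.
by rewrite adj_irrefl !finset.inE -(xflip (inr v)) => /(_ xl).
Qed.

Definition box_space (R : realType) (H : sgraph) : Z2space :=
  Z2Space (@box_flipK R H) (@box_flip_continuous R H) (@box_flip_free R H).

(* Main.v *)
(* Write [cn A] for the set of common neighbors of [A].  A graph [H] in which every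
   chain of closed sets ([cn (cn A) = A], both [A] and [cn A] nonempty) has at most
   [d + 1] members satisfies ind(B(H)) <= d.  Indeed the superlevel sets S of the first
   coordinates and T of the second coordinates of a point of B(H) yield closed sets
   [cn (cn S)], [cn T] that form a chain.  Put closed sets on the moment curve of
   R^(d+1), opposite to each other for [A] and [cn A]; points of a chain are then
   linearly independent, so a positive combination of them is nonzero and can be
   normalized.

   In a chain of Delta + 2 closed sets A1 < A2 < A3 < ... of the total graph, [A2]
   contains two elements with at least Delta + 1 common neighbors.  Sending a common
   neighbor to a graph neighbor of a suitable vertex shows that the two are either two
   disjoint edges or a vertex and an edge avoiding it, with common neighbors among
   four explicit elements, any three of which determine the pair; this rules out
   [A3] when Delta >= 3, and forces [A1] to have degree at least 5 when Delta = 2. *)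
Require Import Defs.
From mathcomp Require Import all_boot all_order all_algebra.
From mathcomp Require Import all_classical all_reals all_analysis.

Set Implicit Arguments.
Unset Strict Implicit.
Unset Printing Implicit Defensive.
Import Order.TTheory GRing.Theory Num.Theory.
Import numFieldTopology.Exports numFieldNormedType.Exports.

Local Open Scope ring_scope.

(** * Common neighbors and closed sets *)

Definition cn (H : sgraph) (A : {set H}) : {set H} :=
  [set v | [forall a in A, adj v a]]%SET.

Definition chain (V : finType) (C : {set {set V}}) : Prop :=
  {in C &, forall A B : {set V}, (A \subset B) || (B \subset A)}.

(* The elements of the Lovasz complex of [H]. *)
Definition cn_closed (H : sgraph) (A : {set H}) : bool :=
  [&& cn (cn A) == A, A != finset.set0 & cn A != finset.set0].

Section CommonNeighbors.
Variable H : sgraph.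
Implicit Types A B : {set H}.

Lemma cnP A v : reflect (forall a, a \in A -> adj v a) (v \in cn A).
Proof. by rewrite finset.inE; exact: forall_inP. Qed.

Lemma sub_cnC A B : (A \subset cn B) = (B \subset cn A).
Proof.
apply/fintype.subsetP/fintype.subsetP => AB x xX; apply/cnP => y yY;
  by rewrite adj_sym; have /cnP := AB _ yY; apply.
Qed.

Lemma sub_cn_cn A : A \subset cn (cn A).
Proof. by rewrite sub_cnC. Qed.

Lemma cnS A B : A \subset B -> cn B \subset cn A.
Proof. by move=> AB; rewrite sub_cnC (fintype.subset_trans AB) ?sub_cn_cn. Qed.

Lemma cn3 A : cn (cn (cn A)) = cn A.
Proof. by apply/eqP; rewrite finset.eqEsubset sub_cn_cn cnS // sub_cn_cn. Qed.

Lemma cn_disjoint A : A != finset.set0 -> ~~ (A \subset cn A).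
Proof.
move=> /finset.set0Pn[a aA]; apply/negP => /fintype.subsetP/(_ a aA)/cnP/(_ a aA).
by rewrite adj_irrefl.
Qed.

Lemma cn_closed_cn A : cn_closed A -> cn_closed (cn A).
Proof. by move=> /and3P[/eqP cA A0 A1]; apply/and3P; rewrite cn3 cA. Qed.

Lemma common_neighborE A : common_neighbor A = (cn A != finset.set0).
Proof.
by apply/existsP/finset.set0Pn => -[v vA]; exists v; rewrite finset.inE in vA *.
Qed.

Lemma cn_closed_cn_of A : A != finset.set0 -> cn A != finset.set0 -> cn_closed (cn A).
Proof.
move=> A0 cA0; rewrite /cn_closed cn3 eqxx cA0 /=.
apply: contraNneq A0 => E; move: (sub_cn_cn A); by rewrite E finset.subset0.
Qed.

End CommonNeighbors.

(** * Labels and signs of closed sets *)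

Section Labels.
Variable H : sgraph.
Implicit Types A B : {set H}.

(** A closed set and its [cn] share one [label], and [positive] holds for exactly one of them: a
    node and a sign for each opposite pair. *)
Definition label A : nat := minn (enum_rank A) (enum_rank (cn A)).

Definition positive A : bool := (enum_rank A < enum_rank (cn A))%N.

Lemma label_cn A : cn_closed A -> label (cn A) = label A.
Proof. by case/and3P => /eqP cA _ _; rewrite /label cA minnC. Qed.

Lemma positive_cn A : cn_closed A -> positive (cn A) = ~~ positive A.
Proof.
case/and3P => /eqP cA A0 _; rewrite /positive cA -leqNgt ltn_neqAle andb_idl // => _.
rewrite (inj_eq val_inj) (inj_eq enum_rank_inj).
by apply: contraNneq (cn_disjoint A0) => ->.
Qed.

(** Equal labels leave [A = B] or [A = cn B]. The latter contradicts comparability, since in a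
    loopless graph a nonempty set is never contained in its own [cn]. *)
Lemma label_inj A B : cn_closed A -> cn_closed B ->
  (A \subset B) || (B \subset A) -> label A = label B -> A = B.
Proof.
have vr (X Y : {set H}) : nat_of_ord (enum_rank X) = enum_rank Y -> X = Y.
  by move=> /val_inj /enum_rank_inj.
move=> /and3P[/eqP cA A0 A1] /and3P[/eqP cB B0 B1] AB lAB.
have [//|E] : A = B \/ A = cn B.
  move: lAB; rewrite /label /minn; do 2 case: ifP => _; move=> /vr.
  - by left.
  - by right.
  - by move=> <-; right; rewrite cA.
  - by move=> E; left; rewrite -cA E cB.
by move: AB; rewrite E (negbTE (cn_disjoint B0)) -{2}cB (negbTE (cn_disjoint B1)).
Qed.

End Labels.

(** * Weights of superlevel sets *)

Section Levels.
Variables (R : realType) (V : finType).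
Implicit Types (a : V -> R) (S : {set V}).

(* Positive exactly when [S] is a nonempty superlevel set of [a] at some
   positive level, and polynomial in the positive parts of the differences. *)
Definition level_weight S a : R :=
  (S != finset.set0)%:R *
  \prod_(v in S) (a v * \prod_(w in ~: S) Num.max 0 (a v - a w)).

Lemma level_weight_ge0 S a : (forall v, 0 <= a v) -> 0 <= level_weight S a.
Proof.
move=> a0; rewrite mulr_ge0 ?ler0n ?prodr_ge0 // => v _.
by rewrite mulr_ge0 ?prodr_ge0 // => w _; rewrite le_max lexx.
Qed.

Lemma level_weight_supp S a v : level_weight S a != 0 -> v \in S -> a v != 0.
Proof.
move=> + vS; apply: contraNN => /eqP av; rewrite /level_weight (bigD1 v) //=.
by rewrite av !mul0r mulr0.
Qed.

Lemma level_weight_neq0 S a : level_weight S a != 0 -> S != finset.set0.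
Proof. by apply: contraNneq => ->; rewrite /level_weight eqxx mul0r. Qed.

Lemma level_weight_lt S a v w :
  level_weight S a != 0 -> v \in S -> w \notin S -> a w < a v.
Proof.
move=> + vS wS; apply: contraNT; rewrite -leNgt => avw.
rewrite /level_weight (bigD1 v) //= (bigD1 w) ?finset.inE //=.
by rewrite max_l ?subr_le0 // mul0r mulr0 mul0r mulr0.
Qed.

(** Incomparable sets would give [v] and [w] with [a w < a v < a w]. *)
Lemma level_weight_chain S T a :
  level_weight S a != 0 -> level_weight T a != 0 -> (S \subset T) || (T \subset S).
Proof.
move=> uS uT; apply: contraT; rewrite negb_or => /andP[].
move=> /fintype.subsetPn[v vS vT] /fintype.subsetPn[w wT wS].
by have := lt_trans (level_weight_lt uS vS wS) (level_weight_lt uT wT vT); rewrite ltxx.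
Qed.

(** The support is the superlevel set at small positive levels, so a nonzero [a] always has a
    positive weight. *)
Lemma level_weight_gt0 a : (forall v, 0 <= a v) -> (exists v, a v != 0) ->
  0 < level_weight [set v | a v != 0]%SET a.
Proof.
move=> a0 [v av]; rewrite /level_weight.
have -> /= : ([set v | a v != 0] != finset.set0)%SET.
  by apply/finset.set0Pn; exists v; rewrite finset.inE.
rewrite mul1r prodr_gt0 // => x; rewrite finset.inE => ax.
have ax0 : 0 < a x by rewrite lt_neqAle eq_sym ax a0.
rewrite mulr_gt0 // prodr_gt0 // => w; rewrite !finset.inE negbK => /eqP ->.
by rewrite subr0 lt_max ax0 orbT.
Qed.

End Levels.

Section Continuity.
Variables (R : realType) (V : finType).

Lemma level_weight_continuous (T : topologicalType) (f : V -> T -> R) (S : {set V}) :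
  (forall v, continuous (f v)) -> continuous (fun x => level_weight S (f^~ x)).
Proof.
move=> fc x; apply: cvgM; first exact: cvg_cst.
apply: continuous_big; first exact: mul_continuous.
move=> v _ {}x; apply: cvgM; first exact: fc.
apply: continuous_big; first exact: mul_continuous.
move=> w _ {}x; apply: (@continuous_max R T (cst 0)); first exact: cvg_cst.
by apply: cvgB; exact: fc.
Qed.

End Continuity.

(** * The signed moment curve *)

Section MomentCurve.
Variables (R : realType) (H : sgraph).

(** Coordinate [j] of the vector [±(1, t, t^2, ...)] at [t = label A]. *)
Definition moment (A : {set H}) (j : nat) : R :=
  (-1) ^+ (~~ positive A) * (label A)%:R ^+ j.

Lemma moment_cn (A : {set H}) j : cn_closed A -> moment (cn A) j = - moment A j.
Proof.
move=> cA; rewrite /moment label_cn // positive_cn // negbK -mulNr; congr (_ * _).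
by case: positive; rewrite ?expr1 ?expr0 ?opprK.
Qed.

(** If [w i0] were nonzero, a polynomial vanishing at the labels of all chain members except [L i0]
    would give a linear form that kills the other members, and the vanishing sum would reduce to the
    positive contribution of [L i0]. *)
Lemma moment_independent (I : finType) (L : I -> {set H}) (w : I -> R) (d : nat) :
  (forall i, 0 <= w i) -> (forall i, w i != 0 -> cn_closed (L i)) ->
  chain [set L i | i in [pred i | w i != 0%R]]%SET ->
  (#|[set L i | i in [pred i | w i != 0%R]]%SET| <= d.+1)%N ->
  (forall j : 'I_d.+1, \sum_i w i * moment (L i) j = 0) ->
  forall i, w i = 0.
Proof.
set C := ([set L i | i in _])%SET => w0 Lc Cch Cd sum0 i0.
apply/eqP; apply: contraT => wi0.
have LC i : w i != 0 -> L i \in C by move=> wi; exact: imset_f.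
pose D := C :\ L i0.
pose p : {poly R} := \prod_(t <- [seq (label A)%:R | A <- enum D]) ('X - t%:P).
(* The degree of [p] is [#|C| - 1], so the [d.+1] vanishing sums cover all its coefficients. *)
have sp : (size p <= d.+1)%N.
  by rewrite size_prod_XsubC size_map -cardE (leq_trans _ Cd) // [in leqRHS](cardsD1 (L i0)) LC.
(* The linear form with the coefficients of [p], evaluated at the moment vector of [A]. *)
pose q (A : {set H}) := (-1) ^+ (~~ positive A) * p.[(label A)%:R].
have q0 : q (L i0) != 0.
  rewrite mulf_neq0 ?signr_eq0 // -rootE root_prod_XsubC.
  apply/mapP => -[A]; rewrite mem_enum !finset.inE => /andP[+ AC] /eqP.
  rewrite eqr_nat => + /eqP lA; apply/negP/negPn/eqP; symmetry.
  have /finset.imsetP[i wi AE] := AC.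
  by apply: label_inj lA; rewrite ?AE ?Lc //; apply: Cch; apply: LC.
have sumq : \sum_i w i * (q (L i) * q (L i0)) = 0.
  under eq_bigr do rewrite mulrA; rewrite -big_distrl /= [X in X * _](_ : _ = 0) ?mul0r //.
  rewrite (eq_bigr (fun i => \sum_(j < d.+1) p`_j * (w i * moment (L i) j))).
    by rewrite exchange_big big1 // => j _; rewrite -big_distrr /= sum0 mulr0.
  move=> i _; rewrite /q (horner_coef_wide _ sp) !big_distrr /=.
  by apply: eq_bigr => j _; rewrite /moment [RHS]mulrCA; congr (_ * _); rewrite mulrCA.
(* Several [i] may share the set [L i0]; the factor [q (L i0)] turns their terms into weighted
   squares, so nothing cancels. *)
have ge0 i : true -> 0 <= w i * (q (L i) * q (L i0)).
  move=> _; have [->|wi] := eqVneq (w i) 0; first by rewrite mul0r.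
  rewrite mulr_ge0 //; have [->|LL] := eqVneq (L i) (L i0); first exact: sqr_ge0.
  suff /rootP pL : root p (label (L i))%:R by rewrite /q pL mulr0 mul0r.
  rewrite root_prod_XsubC; apply: (map_f (fun A => (label A)%:R)).
  by rewrite mem_enum !finset.inE LL LC.
move/eqP: sumq; rewrite psumr_eq0 // => /allP/(_ i0 (mem_index_enum _)).
by rewrite mulf_eq0 (negbTE wi0) -expr2 sqrf_eq0 (negbTE q0).
Qed.

End MomentCurve.

(** * The equivariant map from the box complex to the sphere *)

Section BoxMap.
Variables (R : realType) (H : sgraph).

(* On the barycentric subdivision this is the affine map sending [S] in the first
   copy of [H] to the moment of [cn (cn S)] and [S] in the second copy to the moment
   of [cn S]; the two are opposite, whence the difference. *)
Definition box_moment (x : H + H -> R) (j : nat) : R :=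
  \sum_(S : {set H}) (level_weight S (fun v => x (inr v)) -
                      level_weight S (fun v => x (inl v))) * moment R (cn S) j.

Lemma box_moment_flip x j : box_moment (fun w => x (flip w)) j = - box_moment x j.
Proof.
rewrite /box_moment -sumrN; apply: eq_bigr => S _.
by rewrite -[RHS]mulNr opprB.
Qed.

(** If all coordinates vanished, independence along the chain of closed sets would make every level
    weight zero, but the support in one of the two copies has positive weight. *)
Lemma box_moment_neq0 (d : nat) (x : {ptws (H + H)%type -> R}) :
  (forall C : {set {set H}}, chain C -> {in C, forall A, cn_closed A} ->
    (#|C| <= d.+1)%N) ->
  x \in realization R (box_complex H) -> exists j : 'I_d.+1, box_moment x j != 0.
Proof.
move=> Hd /set_mem[x0 x1]; rewrite /= box_simplicesE => AB.
apply/existsP; apply: contraT => /existsPn sum0.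
pose y (i : bool) v := x (if i then inr v else inl v).
have y0 i v : 0 <= y i v by exact: x0.
(* Both copies are indexed together, [false] for the first and [true] for the second; [L] gives the
   closed set attached to a level set. *)
pose w (i : bool * {set H}) := level_weight i.2 (y i.1).
pose L (i : bool * {set H}) := if i.1 then cn i.2 else cn (cn i.2).
have wsub b S : level_weight S (y b) != 0 ->
    S \subset [set v | y b v != 0%R]%SET.
  by move=> wS; apply/fintype.subsetP => v vS; rewrite finset.inE (level_weight_supp wS).
have Ssub S T : level_weight S (y false) != 0 -> level_weight T (y true) != 0 ->
    S \subset cn T.
  move=> /wsub/fintype.subsetP SA /wsub/fintype.subsetP TB.
  apply/fintype.subsetP => v vS; apply/cnP => u uT.
  case/and3P: AB => /forall_inP/(_ v) + _ _.
  rewrite !finset.inE; have := SA v vS; rewrite finset.inE => -> /(_ isT).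
  by move=> /forall_inP; apply; rewrite !finset.inE; have := TB u uT; rewrite finset.inE.
have Scn b S : level_weight S (y b) != 0 -> cn_closed (cn S).
  move=> wS; apply: cn_closed_cn_of; first exact: level_weight_neq0 wS.
  rewrite -common_neighborE; apply: common_neighbor_sub (wsub _ _ wS) _.
  suff: common_neighbor (if b then inr @^-1: [set w | x w != 0%R]
                         else inl @^-1: [set w | x w != 0%R])%SET.
    by congr (is_true (common_neighbor _)); case: (b); apply/finset.setP => v; rewrite !finset.inE.
  case: b {wS}; first exact: box_simplex_neighbor AB.
  by rewrite box_simplexC in AB; exact: box_simplex_neighbor AB.
have wc i : w i != 0 -> cn_closed (L i).
  by case: i => -[] S /= /Scn // cS; exact: cn_closed_cn.
(* Within a copy the level sets are nested. Across the copies, [S \subset cn T] gives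
   [cn (cn S) \subset cn T]. *)
have Lch : chain [set L i | i in [pred i | w i != 0%R]]%SET.
  move=> _ _ /finset.imsetP[[b S] wS ->] /finset.imsetP[[c T] wT ->].
  have {}wS : level_weight S (y b) != 0 := wS.
  have {}wT : level_weight T (y c) != 0 := wT.
  move: b c wS wT; rewrite /L => -[] [] wS wT /=.
  + by case/orP: (level_weight_chain wS wT) => /cnS ->; rewrite ?orbT.
  + by rewrite [X in _ || X](_ : _ = true) ?orbT // -[in X in _ \subset X](cn3 S) cnS // cnS // Ssub.
  + by rewrite [X in X || _](_ : _ = true) // -[in X in _ \subset X](cn3 T) cnS // cnS // Ssub.
  + by case/orP: (level_weight_chain wS wT) => /cnS/cnS ->; rewrite ?orbT.
have w00 : forall i, w i = 0.
  apply: (@moment_independent R H _ L w d) => //.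
  - by move=> i; apply: level_weight_ge0.
  - apply: Hd Lch _ => _ /finset.imsetP[i wi ->]; exact: wc.
  (* The moment of [cn (cn S)] is minus that of [cn S], which accounts for the difference in
     [box_moment]. *)
  - move=> j; rewrite -[RHS](eqP (negPn (sum0 j))) /box_moment.
    rewrite -(pair_bigA _ (fun b S => w (b, S) * moment R (L (b, S)) j)) big_bool /= -big_split /=.
    apply: eq_bigr => S _; rewrite /w /L /= mulrBl; congr (_ + _).
    have [->|wS] := eqVneq (level_weight S (y false)) 0; first by rewrite !mul0r oppr0.
    by rewrite moment_cn ?mulrN // (Scn _ _ wS).
have [u xu] : exists w, x w != 0.
  apply/existsP; apply: contraT => /existsPn xx.
  move/eqP: x1; rewrite big1 ?(eq_sym 0) ?oner_eq0 // => u _; exact/eqP/negPn/xx.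
have [b [v bv]] : exists b v, y b v != 0.
  by case: u xu => v xv; [exists false | exists true]; exists v.
have := level_weight_gt0 (y0 b) (ex_intro _ v bv).
by rewrite -/(w (b, _)) w00 ltxx.
Qed.

Lemma box_moment_continuous (T : topologicalType) (f : H + H -> T -> R) j :
  (forall w, continuous (f w)) -> continuous (fun x => box_moment (f^~ x) j).
Proof.
move=> fc; apply: continuous_big; first exact: add_continuous.
move=> S _ x; apply: cvgM; last exact: cvg_cst.
apply: cvgB.
  exact: (@level_weight_continuous R H T (fun v => f (inr v))).
exact: (@level_weight_continuous R H T (fun v => f (inl v))).
Qed.

Lemma coordinate_continuous (w : H + H) :
  continuous (fun x : realization R (box_complex H) => val x w).
Proof.
move=> x; apply: (@continuous_comp _ _ _
  (val : realization R (box_complex H) -> {ptws (H + H)%type -> R})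
  (fun y : {ptws (H + H)%type -> R} => y w)).
  exact: initial_continuous.
exact: proj_continuous.
Qed.

Definition normalize (n : nat) (u : 'rV[R]_n.+1) : 'rV[R]_n.+1 :=
  (Num.sqrt (\sum_i u 0 i ^+ 2))^-1 *: u.

(** Expanding the row vector in the basis [delta_mx 0 j] reduces continuity to scalar
    coordinates. *)
Lemma normalize_continuous (T : topologicalType) (n : nat) (g : T -> 'rV[R]_n.+1) :
  (forall i, continuous (fun x => g x 0 i)) -> (forall x, 0 < \sum_i g x 0 i ^+ 2) ->
  continuous (fun x => normalize (g x)).
Proof.
move=> gc g0; rewrite (_ : (fun x => _) =
    fun x => \sum_j (Num.sqrt (\sum_i g x 0 i ^+ 2))^-1 * g x 0 j *: delta_mx 0 j).
  apply: continuous_big; first exact: add_continuous.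
  move=> j _ x; apply: cvgZr_tmp; apply: cvgM; last exact: gc.
  apply: cvgV; first by rewrite gt_eqF // sqrtr_gt0.
  apply: (@continuous_comp _ _ _ (fun x => \sum_i g x 0 i ^+ 2) Num.sqrt);
    last exact: sqrt_continuous.
  move: x; apply: continuous_big; first exact: add_continuous.
  by move=> i _ x; apply: cvgM; exact: gc.
apply/funext => x; rewrite [LHS]row_sum_delta; apply: eq_bigr => j _.
by rewrite mxE.
Qed.

Lemma box_Z2map (d : nat) :
  (forall C : {set {set H}}, chain C -> {in C, forall A, cn_closed A} ->
    (#|C| <= d.+1)%N) ->
  exists f : box_space R H -> Z2sphere R d, Z2map f.
Proof.
move=> Hd; pose g (x : realization R (box_complex H)) : 'rV[R]_d.+1 :=
  \row_j box_moment (val x) j.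
have n0 x : 0 < \sum_i g x 0 i ^+ 2.
  have [j] := box_moment_neq0 Hd (valP x).
  have <- : g x 0 j = box_moment (val x) j by rewrite mxE.
  rewrite -sqrf_eq0 => gj.
  rewrite (bigD1 j) //= ltr_pwDl ?sumr_ge0 // => [|i _]; last exact: sqr_ge0.
  by rewrite lt_neqAle eq_sym gj sqr_ge0.
have gS x : normalize (g x) \in sphere R d.
  apply/mem_set; rewrite /sphere /normalize.
  under eq_bigr do rewrite mxE exprMn.
  by rewrite -big_distrr /= exprVn sqr_sqrtr ?ltW // mulVf // gt_eqF.
exists (fun x => exist _ (normalize (g x)) (gS x) : sphere R d); split; last first.
  move=> x; apply: val_inj; rewrite /= /normalize.
  have -> : g (box_flip x) = - g x.
    by apply/rowP => j; rewrite !mxE box_moment_flip.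
  rewrite scalerN; congr (- ((Num.sqrt _)^-1 *: _)).
  by apply: eq_bigr => i _; rewrite !mxE sqrrN.
apply/continuous_comp_initial/normalize_continuous => // j.
rewrite (_ : (fun x => _) = fun x : realization R (box_complex H) => box_moment (val x) j).
  exact: (@box_moment_continuous _ (fun w (x : realization R (box_complex H)) => val x w)
    j coordinate_continuous).
by apply/funext => x; rewrite mxE.
Qed.

End BoxMap.

Local Open Scope nat_scope.
Local Open Scope set_scope.

(** * Sizes of chains of sets *)

Section Chains.

Lemma chain_sub (V : finType) (C D : {set {set V}}) : D \subset C -> chain C -> chain D.
Proof. by move=> /fintype.subsetP DC Cch A B AD BD; apply: Cch; apply: DC. Qed.

(** Cardinality is injective on a chain and here takes values from 1 to [#|X|]. *)
Lemma chain_card (V : finType) (C : {set {set V}}) (X : {set V}) :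
  chain C -> {in C, forall A : {set V}, A != finset.set0 /\ A \subset X} -> #|C| <= #|X|.
Proof.
move=> Cch CX; pose f (A : {set V}) : 'I_#|X|.+1 := inord #|A|.
have fE A : A \in C -> f A = #|A| :> nat.
  by move=> /CX[_ AX]; rewrite inordK // ltnS subset_leq_card.
rewrite -(card_in_imset (f := f)) => [|A B AC BC /(congr1 val)]; last first.
  rewrite /= !fE // => AB; apply/eqP.
  case/orP: (Cch _ _ AC BC) => sAB; last rewrite eq_sym;
    by rewrite eqEcard sAB AB leqnn.
rewrite -[#|X|]/(#|X|.+1.-1) -[in leqRHS](card_ord #|X|.+1) -(cardsC1 ord0).
apply/subset_leq_card/fintype.subsetP => _ /finset.imsetP[A AC ->].
by rewrite !finset.inE -val_eqE /= fE // cards_eq0; case: (CX _ AC).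
Qed.

(** A member of least cardinality is contained in all others. The map [cn], injective on closed
    sets, turns [C] into a chain of nonempty subsets of [cn A]. *)
Lemma chain_bottom (H : sgraph) (C : {set {set H}}) :
  chain C -> {in C, forall A, cn_closed A} -> C != finset.set0 ->
  exists A, [/\ A \in C, {in C, forall B : {set H}, A \subset B} & #|C| <= #|cn A|].
Proof.
move=> Cch Cc /finset.set0Pn[A0 A0C].
case: (arg_minnP (fun A : {set H} => #|A|) A0C) => A AC Amin.
have AB : {in C, forall B : {set H}, A \subset B}.
  move=> B BC; case/orP: (Cch _ _ AC BC) => // BA.
  by suff /eqP -> : B == A by []; rewrite eqEcard BA Amin.
exists A; split=> //.
have cnK : {in C, cancel (@cn H) (@cn H)} by move=> B /Cc/and3P[/eqP].
rewrite -(card_in_imset (can_in_inj cnK)).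
apply: chain_card => [_ _ /finset.imsetP[B BC ->] /finset.imsetP[D DC ->]|
                      _ /finset.imsetP[B BC ->]].
  by case/orP: (Cch _ _ BC DC) => /cnS ->; rewrite ?orbT.
by split; [case/and3P: (Cc _ BC) | apply: cnS; exact: AB].
Qed.

End Chains.

(** * Adjacency and degrees in the total graph *)

Section TotalGraph.
Variable G : sgraph.
Notation H := (total_graph G).
Implicit Types (e f : edge G) (a b c d p u v w : G) (x y z : H) (S T : {set H}).


(** Represents vertices and edges alike as sets of vertices of [G], so that finite case analyses can
    treat both kinds together. *)
Definition trace z : {set G} := match z with inl v => [set v] | inr e => val e end.

Lemma adj_neq u v : adj u v -> u != v.
Proof. by apply: contraTneq => ->; rewrite adj_irrefl. Qed.

Lemma edgeP e : exists u v, [/\ adj u v, u != v & val e = [set u; v]].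
Proof.
case: e => /= A /finset.imset2P[u v _]; rewrite finset.inE => /andP[_ uv] ->.
by exists u, v; rewrite adj_neq.
Qed.

Lemma edge_card e : #|val e| = 2.
Proof. by have [u [v [_ uv ->]]] := edgeP e; rewrite cards2 uv. Qed.

Lemma edge_end e u : u \in val e -> exists2 v, adj u v & val e = [set u; v].
Proof.
have [a [b [ab _ ->]]] := edgeP e; rewrite !finset.inE => /orP[] /eqP ->.
  by exists b.
by exists a; [rewrite adj_sym | rewrite finset.setUC].
Qed.

Lemma edge_eq e u v : u != v -> (val e == [set u; v]) = (u \in val e) && (v \in val e).
Proof.
move=> uv; apply/idP/andP => [/eqP->|[ue ve]]; first by rewrite !finset.inE !eqxx orbT.
rewrite eq_sym eqEcard cards2 uv edge_card leqnn andbT.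
by apply/fintype.subsetP => w; rewrite !finset.inE => /orP[] /eqP ->.
Qed.

Lemma edge_adj e u v : u \in val e -> v \in val e -> u != v -> adj u v.
Proof.
move=> /edge_end[w uw ->]; rewrite !finset.inE => /orP[] /eqP -> //.
by rewrite eqxx.
Qed.

Lemma meets2 (A : {set G}) u v :
  (A :&: [set u; v] != finset.set0) = (u \in A) || (v \in A).
Proof.
apply/finset.set0Pn/orP => [[w]|].
  by rewrite !finset.inE => /andP[wA /orP[] /eqP <-]; [left | right].
by case=> h; [exists u | exists v]; rewrite !finset.inE h eqxx ?orbT.
Qed.

Lemma meets1 (A : {set G}) u : (A :&: [set u] != finset.set0) = (u \in A).
Proof. by rewrite -[X in _ :&: X]finset.setUid meets2 orbb. Qed.

Definition edge_of u v (uv : adj u v) : edge G.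
Proof.
exists [set u; v]; apply/finset.imset2P; exists u v => //.
by rewrite finset.inE uv.
Defined.

Lemma trace_inj : injective trace.
Proof.
have vE v e : [set v] <> val e by move/(congr1 (fun A : {set G} => #|A|)); rewrite cards1 edge_card.
move=> [v|e] [w|f] //=; [by move/finset.set1_inj-> | by move/vE | by move/esym/vE |].
by move/val_inj->.
Qed.

Lemma edge_adjE e z : adj (inr e : H) z = (val e != trace z) && (val e :&: trace z != finset.set0).
Proof.
case: z => [v|f] //=; rewrite -[LHS]/(v \in val e).
have -> : val e != [set v].
  by apply: contra_eqN (edge_card e) => /eqP ->; rewrite cards1.
by rewrite meets1.
Qed.

(** [trace] is injective, so it embeds [S] into the entries of [s] that satisfy [P]. *)
Lemma card_count S (s : seq {set G}) (P : pred {set G}) :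
  {in S, forall z, trace z \in s} -> {in S, forall z, P (trace z)} -> #|S| <= count P s.
Proof.
move=> Ss SP; rewrite cardE -(size_map trace) -size_filter.
apply: uniq_leq_size => [|_ /mapP[z + ->]].
  by rewrite map_inj_uniq ?enum_uniq //; exact: trace_inj.
by rewrite mem_enum mem_filter => zS; rewrite SP // Ss.
Qed.

Lemma count4 (P : pred {set G}) (A B C D : {set G}) :
  3 <= count P [:: A; B; C; D] ->
  [\/ [/\ P A, P B & P C], [/\ P A, P B & P D],
      [/\ P A, P C & P D] | [/\ P B, P C & P D]].
Proof.
rewrite /=; do 4 case: (P _); rewrite // => _; by
  [constructor 1 | constructor 2 | constructor 3 | constructor 4].
Qed.

Lemma degree_le v : #|[set w | adj v w]| <= max_degree G.
Proof. exact: (@leq_bigmax _ (fun v => #|[set w | adj v w]|)). Qed.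

Lemma degree_ge3 a b c d : adj a b -> adj a c -> adj a d -> b != c -> b != d -> c != d ->
  2 < max_degree G.
Proof.
move=> ab ac ad bc bd cd; apply: leq_trans (degree_le a).
have <- : #|[set b; c; d]| = 3.
  by rewrite -finset.setUA cardsU1 cards2 cd !finset.inE negb_or bc bd.
by apply/subset_leq_card/fintype.subsetP => x; rewrite !finset.inE => /orP[/orP[]|] /eqP ->.
Qed.

Lemma card_nbr_cover S v (g : G -> {set G}) :
  {in S, forall z, exists2 w, adj v w & trace z = g w} -> #|S| <= max_degree G.
Proof.
move=> Sg; rewrite -(card_imset _ trace_inj).
apply: leq_trans (leq_trans (leq_imset_card g _) (degree_le v)).
apply/subset_leq_card/fintype.subsetP => _ /finset.imsetP[z /Sg[w vw ->] ->].
by apply: imset_f; rewrite finset.inE.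
Qed.

Lemma card_nbr_cover2 S u v (g h : G -> {set G}) :
  {in S, forall z, (exists2 w, adj u w & trace z = g w) \/ (exists2 w, adj v w & trace z = h w)} ->
  #|S| <= 2 * max_degree G.
Proof.
move=> Sg; rewrite -(cardsID [set z | [exists w, adj u w && (trace z == g w)]]).
rewrite mul2n -addnn leq_add //.
  apply: (@card_nbr_cover _ u g) => z; rewrite !finset.inE => /andP[_ /existsP[w /andP[uw /eqP]]].
  by exists w.
apply: (@card_nbr_cover _ v h) => z; rewrite !finset.inE => /andP[/existsPn zu /Sg[] //].
by case=> w uw E; have := zu w; rewrite uw E eqxx.
Qed.

(** Already one element of the total graph has at most [2 * max_degree G] neighbors. *)
Lemma card_cn_total S : S != finset.set0 -> #|cn S| <= 2 * max_degree G.
Proof.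
case/finset.set0Pn => -[v|e] zS.
  apply: (@card_nbr_cover2 _ v v (fun w => [set w]) (fun w => [set v; w])).
  move=> z /cnP/(_ _ zS); rewrite adj_sym; case: z => [w|f] /=; first by left; exists w.
  by move=> /edge_end[w vw E]; right; exists w.
have [u [v [uv nuv E]]] := edgeP e.
(* The edges at [u] other than [e] use the neighbors [w != v]; the slot [w = v], which would give
   [e], is taken by the end [u] itself. The same holds at [v]. *)
apply: (@card_nbr_cover2 _ u v (fun w => if w == v then [set u] else [set u; w])
  (fun w => if w == u then [set v] else [set v; w])).
move=> z /cnP/(_ _ zS); rewrite adj_sym edge_adjE finset.setIC E meets2.
case: z => [w|f] /=.
  rewrite !finset.inE => /andP[_ /orP[] /eqP <-].
    by left; exists v => //; rewrite eqxx.
  by right; exists u; rewrite 1?adj_sym // eqxx.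
rewrite eq_sym edge_eq // => /andP[nf /orP[uf|vf]].
  left; move: nf; rewrite uf /=; have [w uw fE] := edge_end uf.
  rewrite fE !finset.inE negb_or => /andP[_ vw]; exists w => //.
  by rewrite eq_sym (negbTE vw).
right; move: nf; rewrite vf andbT; have [w vw fE] := edge_end vf.
rewrite fE !finset.inE negb_or => /andP[_ uw]; exists w => //.
by rewrite eq_sym (negbTE uw).
Qed.


(** * Common neighbors of pairs in the total graph *)

Lemma in_cn2 x y z : (z \in cn [set x; y]) = adj z x && adj z y.
Proof.
apply/cnP/andP => [zxy|[zx zy] a]; first by split; apply: zxy; rewrite !finset.inE eqxx ?orbT.
by rewrite !finset.inE => /orP[] /eqP ->.
Qed.

(** An edge containing both ends of [f] is [f] itself, hence the exclusive or. *)
Lemma edge_adj2 e f u v : u != v -> val f = [set u; v] ->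
  adj (inr e : H) (inr f) = (u \in val e) (+) (v \in val e).
Proof.
by move=> uv fE; rewrite edge_adjE /= fE meets2 edge_eq //; case: (u \in _); case: (v \in _).
Qed.

Lemma card_cn_vertices u v : u != v ->
  #|cn [set (inl u : H); (inl v : H)]| <= max_degree G.
Proof.
(* The vertex [v] is not its own neighbor, so its slot is free for the edge joining [u] and [v]. *)
move=> uv; apply: (@card_nbr_cover _ u (fun w => if w == v then [set u; v] else [set w])).
move=> [w|f]; rewrite in_cn2 /= => /andP[].
  rewrite ![adj w _]adj_sym => uw vw; exists w => //.
  by rewrite eq_sym (negbTE (adj_neq vw)).
move=> uf vf; exists v; first exact: edge_adj uf vf uv.
by rewrite eqxx; apply/eqP; rewrite edge_eq // uf.
Qed.

Lemma card_cn_incident v e : v \in val e ->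
  #|cn [set (inl v : H); (inr e : H)]| <= max_degree G.
Proof.
move=> /edge_end[u vu eE].
(* The slot of [u], which would give [e], is used for the vertex [u]. *)
apply: (@card_nbr_cover _ v (fun w => if w == u then [set u] else [set v; w])).
move=> [w|f]; rewrite in_cn2 => /andP[].
  rewrite /= eE !finset.inE => wv /orP[] /eqP E; first by rewrite E adj_irrefl in wv.
  by exists u; rewrite // E eqxx.
move=> vf; have [w vw fE] := edge_end vf; rewrite adj_sym => ef.
exists w; rewrite // ifN //; apply: contraTneq ef => wu.
by rewrite edge_adjE eE /= fE wu eqxx.
Qed.

Lemma card_cn_meeting v e f : e != f -> v \in val e -> v \in val f ->
  #|cn [set (inr e : H); (inr f : H)]| <= max_degree G.
Proof.
move=> ef /edge_end[a va eE] /edge_end[b vb fE].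
have ab : a != b by apply: contraNneq ef => ab; apply/eqP/val_inj; rewrite eE fE ab.
have nva := adj_neq va; have nvb := adj_neq vb.
(* The slots of [a] and [b], which would give [e] and [f], are used for the vertex [v] and the edge
   joining [a] and [b]. *)
apply: (@card_nbr_cover _ v (fun w => if w == a then [set v] else
  if w == b then [set a; b] else [set v; w])).
move=> [w|h]; rewrite in_cn2.
  rewrite /= eE fE !finset.inE => wef; exists a; rewrite ?eqxx //; congr [set _].
  move: wef; have [//|_ /=] := eqVneq w v.
  by case/andP => /eqP ->; rewrite (negbTE ab).
rewrite (edge_adj2 h nva eE) (edge_adj2 h nvb fE).
have [vh|vh] /= := boolP (v \in val h).
  have [w vw hE] := edge_end vh; rewrite hE !finset.inE !(eq_sym _ v).
  rewrite (negbTE nva) (negbTE nvb) /= => /andP[aw bw]; exists w => //.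
  by rewrite eq_sym (negbTE aw) eq_sym (negbTE bw).
move=> /andP[ah bh]; exists b => //; rewrite eq_sym (negbTE ab) eqxx.
by apply/eqP; rewrite edge_eq // ah.
Qed.

(* The two kinds of pairs that can have more than [max_degree G] common
   neighbors: a vertex and an edge avoiding it, and two disjoint edges. *)
Definition exceptional x y : Prop :=
  [/\ #|cn [set x; y]| <= 4,
      forall S, S \subset cn [set x; y] -> 2 < #|S| -> cn S \subset [set x; y]
    & max_degree G = 2 -> 2 < #|cn [set x; y]| -> #|cn [set x; y]| = 4].

Lemma exceptional_avoiding v e : v \notin val e -> exceptional (inl v) (inr e).
Proof.
have [u [w [uw nuw eE]]] := edgeP e.
rewrite eE !finset.inE negb_or => /andP[nvu nvw].
rewrite /exceptional; set X := cn [set _; _].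
pose s := [:: [set u]; [set w]; [set v; u]; [set v; w]].
have Xs : {in X, forall z, trace z \in s}.
  move=> [a|f]; rewrite in_cn2 => /andP[].
    by rewrite /= eE !finset.inE => _ /orP[] /eqP ->; rewrite eqxx ?orbT.
  rewrite -[adj (inr f : H) (inl v : H)]/(v \in val f) (edge_adj2 f nuw eE) /= => vf.
  rewrite !finset.inE !edge_eq // vf /=.
  by case: (u \in _); case: (w \in _); rewrite // !orbT.
split.
- by rewrite -[4]/(size s) -(count_predT s); apply: card_count.
- move=> S /fintype.subsetP SX S3; apply/fintype.subsetP => -[a|f] /cnP aS.
    (* A vertex adjacent to an element avoids its trace if that is a singleton and lies in it if it
       is a pair. Among [s], three such conditions force [a = v]. *)
    pose P (A : {set G}) := if #|A| == 1 then a \notin A else a \in A.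
    have SP : {in S, forall z, P (trace z)}.
      move=> z zS; have := aS z zS; rewrite /P; case: z zS => [b|g] _ /=.
        by rewrite cards1 /= finset.inE; exact: adj_neq.
      by rewrite edge_card.
    have := leq_trans S3 (@card_count S s P (fun z zS => Xs z (SX z zS)) SP).
    suff av : a == v -> inl a \in [set (inl v : H); (inr e : H)].
      move: av; set Q := inl a \in _ => av.
      move/count4; rewrite /P !cards1 !cards2 nvu nvw /=.
      rewrite !(finset.in_setU, finset.in_set1).
      by case: (a == v) av => [->//|_]; case: (a == u); case: (a == w); case=> -[].
    by move/eqP->; rewrite finset.set21.
  pose P (A : {set G}) := (val f != A) && (val f :&: A != finset.set0).
  have SP : {in S, forall z, P (trace z)}.
    by move=> z /aS; rewrite edge_adjE.
  have := leq_trans S3 (@card_count S s P (fun z zS => Xs z (SX z zS)) SP).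
  suff : val f == val e -> inr f \in [set (inl v : H); (inr e : H)].
    rewrite eE edge_eq // => fe /count4; move: fe.
    rewrite /P !meets1 !meets2 !edge_eq //.
    case: (u \in _); case: (w \in _); case: (v \in _) => fe;
      by [move=> _; exact: fe | case=> -[]; rewrite ?andbF].
  by move/eqP/val_inj->; rewrite finset.set22.
- move=> D2 X3; apply/eqP; rewrite eqn_leq; apply/andP; split.
    by rewrite -[4]/(size s) -(count_predT s); apply: card_count.
  (* The candidates [{u}] and [{v, u}] both require [adj v u], the other two [adj v w]. Three
     candidates thus give both adjacencies, and then all four are present. *)
  pose P (A : {set G}) := if u \in A then adj v u else adj v w.
  have XP : {in X, forall z, P (trace z)}.
    move=> [a|f]; rewrite in_cn2 => /andP[].
      rewrite /P /= eE !finset.inE adj_sym => va /orP[] /eqP aE; first by rewrite -aE eqxx.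
      by rewrite -aE; case: ifP va => // /eqP ->.
    rewrite -[adj (inr f : H) (inl v : H)]/(v \in val f) (edge_adj2 f nuw eE) /P /= => vf.
    case: ifP => [uf _|uf /= wf]; first exact: edge_adj vf uf nvu.
    exact: edge_adj vf wf nvw.
  have [vu vw] : adj v u /\ adj v w.
    have := leq_trans X3 (@card_count X s P Xs XP).
    move/count4; rewrite /P !finset.inE eqxx orbT (negbTE nuw) (eq_sym u) (negbTE nvu).
    by case=> -[].
  pose t : seq H := [:: inl u; inl w; inr (edge_of vu); inr (edge_of vw)].
  have ut : uniq t.
    have lr (p : G) (g : edge G) : ((inl p : H) == (inr g : H)) = false by apply/eqP.
    have uw' : ((inl u : H) == (inl w : H)) = false by apply/eqP => -[]; apply/eqP.
    have vuw : ((inr (edge_of vu) : H) == (inr (edge_of vw) : H)) = false.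
      apply/eqP => -[] /finset.setP/(_ u); rewrite !finset.inE eqxx orbT.
      by rewrite (negbTE nuw) orbF eq_sym (negbTE nvu).
    by rewrite cons_uniq cons_uniq cons_uniq !in_cons !in_nil !lr uw' vuw.
  rewrite -[4]/(size t) -(card_uniqP ut); apply/subset_leq_card/fintype.subsetP => z.
  rewrite !in_cons in_nil orbF in_cn2 => /or4P[] /eqP ->.
  + by rewrite /= eE !finset.inE eqxx adj_sym vu.
  + by rewrite /= eE !finset.inE eqxx orbT adj_sym vw.
  + rewrite (edge_adj2 _ nuw eE) /= !finset.inE !eqxx orbT.
    by rewrite (eq_sym w v) (negbTE nvw) (eq_sym w u) (negbTE nuw).
  + by rewrite (edge_adj2 _ nuw eE) /= !finset.inE !eqxx orbT (eq_sym u) (negbTE nvu) (negbTE nuw).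
Qed.

Lemma exceptional_disjoint e f : val e :&: val f = finset.set0 ->
  exceptional (inr e) (inr f).
Proof.
have [a [b [ab nab eE]]] := edgeP e; have [c [d [cd ncd fE]]] := edgeP f.
move=> ef0.
have [nac nad nbc nbd] : [/\ a != c, a != d, b != c & b != d].
  have n p q : p \in val e -> q \in val f -> p != q.
    move=> pe qf; apply: contraTneq pe => ->; apply/negP => qe.
    by have := finset.in_set0 q; rewrite -ef0 finset.inE qe qf.
  by split; apply: n; rewrite ?eE ?fE !finset.inE eqxx ?orbT.
rewrite /exceptional; set X := cn [set _; _].
pose s := [:: [set a; c]; [set a; d]; [set b; c]; [set b; d]].
have Xs : {in X, forall z, trace z \in s}.
  move=> [p|g]; rewrite in_cn2.
    rewrite /= eE fE !finset.inE => /andP[/orP[] /eqP ->].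
      by rewrite (negbTE nac) (negbTE nad).
    by rewrite (negbTE nbc) (negbTE nbd).
  rewrite (edge_adj2 g nab eE) (edge_adj2 g ncd fE) /= !in_cons in_nil orbF !edge_eq //.
  by case: (a \in _); case: (b \in _); case: (c \in _); case: (d \in _).
split.
- by rewrite -[4]/(size s) -(count_predT s); apply: card_count.
- move=> S /fintype.subsetP SX S3; apply/fintype.subsetP => -[p|g] /cnP pS.
    (* Each vertex lies on at most two of the four pairs in [s], so no vertex is adjacent to three
       of them. *)
    have SP : {in S, forall z, p \in trace z}.
      move=> z zS; have := pS z zS; have := Xs z (SX z zS); case: z zS => [q|g] _ //=.
      move=> E; exfalso; have : #|[set q]| = 2; last by rewrite cards1.
      by move: E; rewrite !in_cons in_nil orbF /= => /or4P[] /eqP ->;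
        rewrite cards2 ?nac ?nad ?nbc ?nbd.
    have := leq_trans S3 (@card_count S s (fun A => p \in A) (fun z zS => Xs z (SX z zS)) SP).
    move/count4; rewrite !(finset.in_setU, finset.in_set1).
    have [->|_] := eqVneq p a; first by
      rewrite (negbTE nab) (negbTE nac) (negbTE nad) /=; case=> -[].
    have [->|_] := eqVneq p b; first by
      rewrite (negbTE nbc) (negbTE nbd) /=; case=> -[].
    have [->|_] := eqVneq p c; first by rewrite (negbTE ncd) /=; case=> -[].
    by case=> -[].
  pose P (A : {set G}) := (val g != A) && (val g :&: A != finset.set0).
  have SP : {in S, forall z, P (trace z)}.
    by move=> z /pS; rewrite edge_adjE.
  have := leq_trans S3 (@card_count S s P (fun z zS => Xs z (SX z zS)) SP).
  suff : (val g == val e) || (val g == val f) -> inr g \in [set (inr e : H); (inr f : H)].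
    rewrite eE fE !edge_eq // => gef /count4; move: gef; rewrite /P !meets2 !edge_eq //.
    case: (a \in _); case: (b \in _); case: (c \in _); case: (d \in _) => gef;
      by [move=> _; exact: gef | case=> -[]].
  by case/orP => /eqP/val_inj->; rewrite ?finset.set21 ?finset.set22.
(* Three of the four edges between [e] and [f] include both edges at [a] or both at [b]; together
   with [e] they give a vertex of degree 3. *)
- move=> D2 X3; exfalso; suff : 2 < max_degree G by rewrite D2.
  have XP : {in X, forall z, trace z \in edges G}.
    move=> [p|g] zX; last exact: valP.
    move: (Xs _ zX) => E; exfalso; have : #|[set p]| = 2; last by rewrite cards1.
    by move: E; rewrite !in_cons in_nil orbF /= => /or4P[] /eqP ->;
        rewrite cards2 ?nac ?nad ?nbc ?nbd.
  have adjE p q : p != q -> [set p; q] \in edges G -> adj p q.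
    move=> pq pqE; pose g : edge G := exist (fun A : {set G} => A \in edges G) _ pqE.
    by apply: (@edge_adj g p q _ _ pq);
      rewrite /= !finset.inE eqxx ?orbT.
  have ba : adj b a by rewrite adj_sym.
  have := leq_trans X3 (@card_count X s (fun A => A \in edges G) Xs XP).
  case/count4 => -[].
  + by move=> /(adjE _ _ nac) ac /(adjE _ _ nad) ad _; exact: degree_ge3 ab ac ad nbc nbd ncd.
  + by move=> /(adjE _ _ nac) ac /(adjE _ _ nad) ad _; exact: degree_ge3 ab ac ad nbc nbd ncd.
  + by move=> _ /(adjE _ _ nbc) bc /(adjE _ _ nbd) bd; exact: degree_ge3 ba bc bd nac nad ncd.
  + by move=> _ /(adjE _ _ nbc) bc /(adjE _ _ nbd) bd; exact: degree_ge3 ba bc bd nac nad ncd.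
Qed.

(** * Chains of closed sets in the total graph *)

Lemma exceptional_sym x y : exceptional x y -> exceptional y x.
Proof. by rewrite /exceptional finset.setUC. Qed.

Lemma card_cn_pair x y : x != y -> #|cn [set x; y]| <= max_degree G \/ exceptional x y.
Proof.
have mixed v e : #|cn [set (inl v : H); (inr e : H)]| <= max_degree G \/
    exceptional (inl v) (inr e).
  have [ve|ve] := boolP (v \in val e); first by left; exact: card_cn_incident.
  by right; exact: exceptional_avoiding.
case: x y => [u|e] [v|f] xy; rewrite ?mixed //.
- by left; exact: card_cn_vertices.
- by rewrite finset.setUC; case: (mixed v e) => [|/exceptional_sym]; [left | right].
- have [ef0|/finset.set0Pn[v]] := eqVneq (val e :&: val f) finset.set0.
    by right; exact: exceptional_disjoint.
  by rewrite finset.inE => /andP[ve vf]; left; exact: card_cn_meeting ve vf.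
Qed.

Lemma card_chain_total (C : {set {set H}}) : chain C -> {in C, forall A, cn_closed A} ->
  #|C| <= (max_degree G).+1.
Proof.
move=> Cch Cc; rewrite leqNgt; apply/negP => CD.
have C0 : C != finset.set0 by rewrite -card_gt0 (leq_trans _ CD).
have [A1 [A1C A1le A1card]] := chain_bottom Cch Cc C0.
(* The chain gives [max_degree G + 2 <= #|cn A1|], and [#|cn A1|] is at most twice the maximum
   degree. *)
have D2 : 1 < max_degree G.
  have /and3P[_ A10 _] := Cc _ A1C.
  have := leq_trans (leq_trans CD A1card) (card_cn_total A10).
  by rewrite mul2n -addnn -add2n leq_add2r.
pose C1 := C :\ A1; have C1sub : C1 \subset C by rewrite finset.subD1set.
have C1card : max_degree G < #|C1| by move: CD; rewrite (cardsD1 A1) A1C.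
have C1c : {in C1, forall A, cn_closed A} by move=> A /(fintype.subsetP C1sub)/Cc.
have C10 : C1 != finset.set0 by rewrite -card_gt0 (leq_trans _ C1card).
have [A2 [A2C1 A2le A2card]] := chain_bottom (chain_sub C1sub Cch) C1c C10.
pose C2 := C1 :\ A2; have C2sub : C2 \subset C1 by rewrite finset.subD1set.
have C2card : max_degree G <= #|C2| by move: C1card; rewrite (cardsD1 A2) A2C1.
have C2c : {in C2, forall A, cn_closed A} by move=> A /(fintype.subsetP C2sub)/C1c.
have C20 : C2 != finset.set0 by rewrite -card_gt0 (leq_trans _ C2card) 1?ltnW.
have [A3 [A3C2 _ A3card]] :=
  chain_bottom (chain_sub (fintype.subset_trans C2sub C1sub) Cch) C2c C20.
have /and3P[/eqP A1K A10 _] := Cc _ A1C.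
have /and3P[/eqP A2K _ _] := C1c _ A2C1.
have /and3P[/eqP A3K _ _] := C2c _ A3C2.
have A12 : A1 \proper A2.
  move: A2C1; rewrite !finset.inE => /andP[n21 A2C].
  by rewrite finset.properEneq eq_sym n21 A1le.
have A23 : A2 \proper A3.
  move: A3C2; rewrite finset.in_setD1 => /andP[n32 A3C1].
  by rewrite finset.properEneq eq_sym n32 A2le.
have A1gt : 0 < #|A1| by rewrite card_gt0.
have A2gt : 1 < #|A2| := leq_ltn_trans A1gt (proper_card A12).
have A3gt : 2 < #|A3| := leq_ltn_trans A2gt (proper_card A23).
have [x [y [xA2 yA2 xy]]] := card_gt1P A2gt.
have xyA2 : [set x; y] \subset A2.
  by apply/fintype.subsetP => z; rewrite !finset.inE => /orP[] /eqP ->.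
have sA2 := cnS xyA2; have sA23 := cnS (fintype.proper_sub A23).
have cA2 : max_degree G < #|cn A2| := leq_trans C1card A2card.
have cxy := leq_trans cA2 (subset_leq_card sA2).
have [|[X4 X3 XD2]] := card_cn_pair xy; first by rewrite leqNgt cxy.
move: D2; rewrite leq_eqVlt => /orP[/eqP D2|D3].
  (* Here [A2] is the pair itself, so [cn A2] has all four elements and the larger [cn A1] at least
     five, more than twice the degree 2. *)
  have A2xy : A2 \subset [set x; y] by rewrite -A2K; apply: X3 sA2 _; rewrite D2.
  have cA2_4 := subset_leq_card (cnS A2xy); rewrite XD2 -?D2 // in cA2_4; last by rewrite D2.
  have cA12 : #|cn A2| < #|cn A1|.
    rewrite proper_card // finset.properEneq cnS ?fintype.proper_sub // andbT.
    apply: contraTneq A12 => E.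
    by rewrite -A1K -A2K E fintype.properxx.
  by have := leq_trans (leq_ltn_trans cA2_4 cA12) (card_cn_total A10); rewrite -D2.
(* [cn A3] has at least [max_degree G >= 3] elements, all common neighbors of [x] and [y], and
   therefore determines the pair; but [A3] has three elements or more. *)
have A3xy : A3 \subset [set x; y].
  rewrite -A3K; apply: X3; first exact: fintype.subset_trans sA23 sA2.
  exact: leq_trans D3 (leq_trans C2card A3card).
by have := subset_leq_card A3xy; rewrite cards2 xy leqNgt A3gt.
Qed.

End TotalGraph.

Theorem theorem1 (R : realType) (G : sgraph) :
  (ind R (box_space R (total_graph G)) <= ((max_degree G)%:Z)%:E)%E.
Proof.
have ex := @box_Z2map R _ _ (@card_chain_total G).
rewrite /ind; case: pselect => [exm|[]]; last by exists (max_degree G); apply/asboolP.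
by rewrite lee_fin lez_nat; case: ex_minnP => m _; apply; apply/asboolP.
Qed.
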